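(* Let $k\ge 1$, $n\ge 1$, let $\mathbf r=(r_1,\dots,r_k)$ with $0\le r_1\le\dots\le r_k\le n$, and let $\mathbf S=(S_1,\dots,S_{k-1})$ with $S_i\subseteq[n]$. Let $\boldsymbol\mu=(\mu_1,\dots,\mu_k)$ be a sequence of valuated matroids on $[n]$, where $\mu_i$ has rank $r_i$. The following are equivalent: (a) $\boldsymbol\mu\in\operatorname{LFlDr}(\mathbf r,\mathbf S;n)$; (b) $\boldsymbol\mu$ is a linear degenerate valuated flag matroid of degeneration type $\mathbf S$, i.e. $(\mu_i)_{S_i}\twoheadleftarrow\mu_{i+1}$ for all $i\in\{1,\dots,k-1\}$; (c) $\mathrm{pr}^{\operatorname{trop}}_{S_i}\big(\overline{\operatorname{trop}}(\mu_i)\big)\subseteq\overline{\operatorname{trop}}(\mu_{i+1})$ for all $i\in\{1,\dots,k-1\}$; (d) for every $i\in\{1,\dots,k-1\}$, the projection $\mathrm{pr}_{S_i}:\mu_{i+1}\to\mu_i$ is a morphism of valuated matroids.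
   Context: Tropical conventions: $\mathbb T=\mathbb R\cup\{\infty\}$ with $a\oplus b=\min(a,b)$, $a\odot b=a+b$. $\mathbb P(\mathbb T^N)=(\mathbb T^N\setminus\{(\infty,\dots,\infty)\})/\mathbb R\mathbf 1$. For a tropical polynomial $F=\bigoplus_u c_u\odot x^u$, its tropical hypersurface $V(F)$ is the set of points where $\min_u\{c_u+\sum_i u_ix_i\}$ is attained at least twice, with the convention that it counts as attained twice if the minimum is $\infty$. A valuated matroid of rank $r$ on $[n]$ is a map $\nu:\binom{[n]}{r}\to\mathbb T$, not identically $\infty$, such that for all $I,J\in\binom{[n]}{r}$ and $i\in I\setminus J$ there is $j\in J\setminus I$ with $\nu(I)+\nu(J)\ge\nu((I\setminus i)\cup j)+\nu((J\setminus j)\cup i)$. Valuated matroids differing by an additive real constant are identified, so $\nu$ is a point of $\mathbb P(\mathbb T^{\binom nr})$. Its underlying matroid has as bases the $B$ with $\nu(B)\ne\infty$. Quotient: for valuated matroids $\mu,\nu$ on $[n]$ of ranks $r\le s$, $\mu\twoheadleftarrow\nu$ means: for all $I\in\binom{[n]}r$, $J\in\binom{[n]}s$, $i\in I\setminus J$ there is $j\in J\setminus I$ with $\mu(I)+\nu(J)\ge\mu(I\cup j\setminus i)+\nu(J\cup i\setminus j)$. Tropical linear space: for $\mu$ of rank $r$ and $I\in\binom{[n]}{r+1}$ let $C_\mu(I)\in\mathbb T^n$ have $C_\mu(I)_i=\mu(I\setminus i)$ for $i\in I$ and $\infty$ otherwise; the valuated circuits are the images in $\mathbb P(\mathbb T^n)$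 of those $C_\mu(I)$ not equal to $(\infty,\dots,\infty)$. $\overline{\operatorname{trop}}(\mu)=\bigcap_{C}V(\bigoplus_{i\in[n]}C_i\odot x_i)\subseteq\mathbb P(\mathbb T^n)$, over all valuated circuits $C$. Tropical projection: for $S\subseteq[n]$, $\mathrm{pr}^{\operatorname{trop}}_S:\mathbb T^n\to\mathbb T^n$ sets coordinates in $S$ to $\infty$ and keeps the others; for $X\subseteq\mathbb P(\mathbb T^n)$, $\mathrm{pr}^{\operatorname{trop}}_S(X)$ is the image in $\mathbb P(\mathbb T^n)$ of $\mathrm{pr}^{\operatorname{trop}}_S(\varphi^{-1}(X))\setminus\{(\infty,\dots,\infty)\}$, where $\varphi$ is the quotient map. Deletion and $\mu_S$: let $\mu$ have rank $r$ and underlying matroid $M$, $S\subseteq[n]$, $k=\operatorname{rk}(M\setminus S)$. Choose $I\subseteq S$ with $|I|=r-k$ such that $([n]\setminus S)\cup I$ has rank $r$ in $M$. Then $\mu_S:\binom{[n]}{k}\to\mathbb T$ is $\mu_S(B)=\mu(B\cup I)$ if $B\cap S=\emptyset$ and $\infty$ otherwise; this is a valuated matroid on $[n]$, independent of the choice of $I$ up to equivalence (the deletion $\mu\setminus S$ with the elements of $S$ added as loops). Linear degenerate flag Dressian: for $S\subseteq[n]$ and $r\le s$, $\mathscr P^{\operatorname{trop}}_{r,s;S;n}$ is the set of tropical polynomials $\bigoplus_{j\in J\setminus(I\cup S)}p_{I\cup j}\odot p_{J\setminus j}$ for $I\in\binom{[n]}{r-1}$, $J\in\binom{[n]}{s+1}$,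 in variables $p_I$ ($I\in\binom{[n]}r$) and $p_J$ ($J\in\binom{[n]}s$); $\mathscr P^{\operatorname{trop}}_{r;n}:=\mathscr P^{\operatorname{trop}}_{r,r;\emptyset;n}$ (tropical Grassmann–Plücker relations). With $S_{ij}=S_i\cup\dots\cup S_{j-1}$, $\operatorname{LFlDr}(\mathbf r,\mathbf S;n)\subseteq\prod_{i=1}^k\mathbb P(\mathbb T^{\binom n{r_i}})$ is the intersection of the tropical hypersurfaces of all polynomials in $\mathscr P^{\operatorname{trop}}_{r_i;n}$ ($1\le i\le k$) and $\mathscr P^{\operatorname{trop}}_{r_i,r_j;S_{ij};n}$ ($1\le i<j\le k$). Morphisms: for a valuated matroid $\mu$ on a ground set $E$ and a new element $o$, $\mu_o=\mu\oplus U_{0,1}$ is $\mu$ on $E\cup\{o\}$ with $o$ a loop (same bases and values). For a surjective map $f:[m]\to[n]$ and $\nu$ of rank $r$ on $[n]$ with underlying matroid $N$, $f^{-1}(\nu)(I)=\nu(f(I))$ if $f(I)$ is a basis of $N$ with $|f(I)|=|I|$, and $\infty$ otherwise; for a general map $f$, $f^{-1}(\nu):=f^{-1}(\nu|_{f([m])})$ where $\nu|_{T}$ is the deletion of the complement of $T$. For $\mu$ on $[m]$ and $\nu$ on $[n]$, a map $f:[m]\cup\{o\}\to[n]\cup\{o\}$ with $f(o)=o$ is a morphism of valuated matroids $f:\mu\to\nu$ if $f^{-1}(\nu_o)\twoheadleftarrow\mu_o$. The projection $\mathrm{pr}_S:[n]\cup\{o\}\to[n]\cup\{o\}$ fixes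 elements outside $S$ and sends elements of $S$ (and $o$) to $o$. *)

(* Defs.v *)
From HB Require Import structures.
From mathcomp Require Import all_boot all_order all_algebra.
From mathcomp Require Import boolp classical_sets reals.

Set Implicit Arguments.
Unset Strict Implicit.
Unset Printing Implicit Defensive.

Import GRing.Theory Num.Theory.

Notation trop R := (option (Real.sort R)).
Notation "'\oo_t'" := (@None _) (at level 0).

Definition tadd (R : realType) (a b : trop R) : trop R :=
  match a, b with
  | Some x, Some y => Some (x + y)%R
  | _, _ => \oo_t
  end.

Definition tle (R : realType) (a b : trop R) : bool :=
  match a, b with
  | _, None => true
  | None, Some _ => false
  | Some x, Some y => (x <= y)%R
  end.

Definition tmin (R : realType) (a b : trop R) : trop R :=
  if tle a b then a else b.

Definition tpow (R : realType) (a : trop R) (n : nat) : trop R :=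
  iter n (tadd a) (Some 0%R).

Notation tspace R N := {ffun N -> trop R}.

Definition tinf (R : realType) (N : finType) : tspace R N := [ffun=> \oo_t].

Definition tvec (R : realType) (N : finType) : Type :=
  {x : tspace R N | x != tinf R N}.
HB.instance Definition _ (R : realType) (N : finType) :=
  Choice.on (tvec R N).

Coercion tvec_val (R : realType) (N : finType) (x : tvec R N) : tspace R N :=
  sval x.

Definition tequiv (R : realType) (N : finType) : rel (tvec R N) :=
  fun x y => `[< exists c : R, forall i, x i = tadd (Some c) (y i) >].

Lemma tequiv_refl (R : realType) (N : finType) : reflexive (@tequiv R N).
Proof.
by move=> x; apply/asboolP; exists 0%R => i; case: (x i) => //= a; rewrite add0r.
Qed.

Lemma tequiv_sym (R : realType) (N : finType) : symmetric (@tequiv R N).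
Proof.
have H (x y : tvec R N) : tequiv x y -> tequiv y x.
  move=> /asboolP[c Hc]; apply/asboolP; exists (- c)%R => i.
  by rewrite Hc; case: (y i) => //= a; rewrite addKr.
by move=> x y; apply/idP/idP; apply: H.
Qed.

Lemma tequiv_trans (R : realType) (N : finType) : transitive (@tequiv R N).
Proof.
move=> y x z /asboolP[c Hc] /asboolP[d Hd]; apply/asboolP.
exists (c + d)%R => i; rewrite Hc Hd.
by case: (z i) => //= a; rewrite addrA.
Qed.

Canonical tequiv_rel (R : realType) (N : finType) :=
  EquivRel (@tequiv R N) (@tequiv_refl R N) (@tequiv_sym R N)
    (@tequiv_trans R N).

Definition tropP (R : realType) (N : finType) : Type :=
  {eq_quot (tequiv_rel R N)}%qT.
HB.instance Definition _ (R : realType) (N : finType) :=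
  Quotient.on (tropP R N).

Definition tphi (R : realType) (N : finType) (x : tvec R N) : tropP R N :=
  (\pi_(tropP R N) x)%qT.

(* A polynomial is a list of terms (coefficient, exponent vector); repeated
   monomials stay separate terms and the minimum is counted over terms. When
   I \subset J and #|J :\: I| = 2, the two terms of the Grassmann-Pluecker
   relation of (I, J) are the same monomial and the relation must be vacuous. *)
Definition tpoly (R : realType) (N : finType) : Type :=
  seq (trop R * {ffun N -> nat}).

Definition tterm (R : realType) (N : finType) (x : tspace R N)
    (t : trop R * {ffun N -> nat}) : trop R :=
  tadd t.1 (\big[@tadd R/Some 0%R]_(i : N) tpow (x i) (t.2 i)).

Definition teval (R : realType) (N : finType) (F : tpoly R N) (x : tspace R N) :
    trop R :=
  \big[@tmin R/ \oo_t]_(t <- F) tterm x t.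

Definition tvanish (R : realType) (N : finType) (F : tpoly R N)
    (x : tspace R N) : Prop :=
  teval F x = \oo_t \/ (2 <= count (fun t => tterm x t == teval F x) F)%N.

Definition hypersurface (R : realType) (N : finType) (F : tpoly R N) :
    set (tropP R N) :=
  [set tphi x | x in [set x : tvec R N | tvanish F x]]%classic.

Definition tjoin (R : realType) (N1 N2 : finType) (x : tspace R N1)
    (y : tspace R N2) : tspace R (N1 + N2)%type :=
  [ffun v => match v with inl a => x a | inr b => y b end].

Definition hypersurface2 (R : realType) (N1 N2 : finType)
    (F : tpoly R (N1 + N2)%type) : set (tropP R N1 * tropP R N2) :=
  [set pq | exists (x : tvec R N1) (y : tvec R N2),
     pq = (tphi x, tphi y) /\ tvanish F (tjoin x y)]%classic.

Notation rset E r := {A : {set E} | #|A| == r}.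
Notation rfun R E r := {ffun rset E r -> trop R}.

(* mu(A), extended by oo to the sets A of cardinality other than r. *)
Definition vm_val (R : realType) (E : finType) (r : nat) (mu : rfun R E r)
    (A : {set E}) : trop R :=
  if insub A is Some B then mu B else \oo_t.

Definition valuated_matroid (R : realType) (E : finType) (r : nat)
    (mu : rfun R E r) : Prop :=
  (exists B, mu B != \oo_t) /\
  forall I J : {set E}, #|I| = r -> #|J| = r ->
  forall i, i \in I :\: J -> exists2 j, j \in J :\: I &
    tle (tadd (vm_val mu (j |: (I :\ i))) (vm_val mu (i |: (J :\ j))))
        (tadd (vm_val mu I) (vm_val mu J)).

Definition is_basis (R : realType) (E : finType) (r : nat) (mu : rfun R E r) :
    pred {set E} :=
  fun B => vm_val mu B != \oo_t.

Definition mrank (R : realType) (E : finType) (r : nat) (mu : rfun R E r)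
    (A : {set E}) : nat :=
  \max_(B : {set E} | is_basis mu B) #|A :&: B|.

Definition vm_quotient (R : realType) (E : finType) (r s : nat)
    (mu : rfun R E r) (nu : rfun R E s) : Prop :=
  (r <= s)%N /\
  forall I J : {set E}, #|I| = r -> #|J| = s ->
  forall i, i \in I :\: J -> exists2 j, j \in J :\: I &
    tle (tadd (vm_val mu (j |: (I :\ i))) (vm_val nu (i |: (J :\ j))))
        (tadd (vm_val mu I) (vm_val nu J)).

Definition circuit_vec (R : realType) (E : finType) (r : nat)
    (mu : rfun R E r) (I : {set E}) : tspace R E :=
  [ffun i => if i \in I then vm_val mu (I :\ i) else \oo_t].

Definition circuits (R : realType) (E : finType) (r : nat) (mu : rfun R E r) :
    set (tropP R E) :=
  [set tphi C | C in [set C : tvec R E |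
     exists I : {set E}, #|I| = r.+1 /\ C = circuit_vec mu I :> tspace R E]]%classic.

Definition linear_form (R : realType) (E : finType) (C : tspace R E) :
    tpoly R E :=
  [seq (C i, [ffun l => nat_of_bool (l == i)]) | i <- enum E].

(* [repr C] is a representative in T^n of the projective point C; the
   hypersurface does not depend on it. *)
Definition trop_linear (R : realType) (E : finType) (r : nat)
    (mu : rfun R E r) : set (tropP R E) :=
  (\bigcap_(C in circuits mu)
     hypersurface (linear_form (tvec_val (repr C : tvec R E))))%classic.

Definition tpr (R : realType) (E : finType) (S : {set E}) (x : tspace R E) :
    tspace R E :=
  [ffun i => if i \in S then \oo_t else x i].

Definition tprP (R : realType) (E : finType) (S : {set E})
    (X : set (tropP R E)) : set (tropP R E) :=
  [set tphi y | y in [set y : tvec R E |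
     exists2 x : tvec R E, X (tphi x) & y = tpr S x :> tspace R E]]%classic.

(* The choice of I does not matter up to an additive constant. *)
Definition del_ext (R : realType) (E : finType) (r : nat) (mu : rfun R E r)
    (S : {set E}) : {set E} :=
  odflt finset.set0
    [pick I : {set E} | [&& I \subset S, #|I| == (r - mrank mu (~: S))%N
                         & mrank mu (~: S :|: I) == r]].

Definition loop_deletion (R : realType) (E : finType) (r : nat)
    (mu : rfun R E r) (S : {set E}) : rfun R E (mrank mu (~: S)) :=
  [ffun B : rset E _ => if [disjoint val B & S] then vm_val mu (val B :|: del_ext mu S)
             else \oo_t].

Definition deletion (R : realType) (E : finType) (r : nat)
    (mu : rfun R E r) (S : {set E}) :
    rfun R {x : E | x \notin S} (mrank mu (~: S)) :=
  [ffun B : rset {x : E | x \notin S} _ =>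
     vm_val mu ((val @: val B) :|: del_ext mu S)].

(* nu|_T, on the ground set T. *)
Definition restriction (R : realType) (E : finType) (r : nat)
    (mu : rfun R E r) (T : {set E}) := deletion mu (~: T).

Definition incidence_poly (R : realType) (E : finType) (r s : nat)
    (S I J : {set E}) : tpoly R (rset E r + rset E s)%type :=
  [seq (Some 0%R,
        [ffun v : rset E r + rset E s =>
           match v with
           | inl A => nat_of_bool (val A == j |: I)
           | inr B => nat_of_bool (val B == J :\ j)
           end]) | j <- enum (J :\: (I :|: S))].

Definition incidence_polys (R : realType) (E : finType) (r s : nat)
    (S : {set E}) : set (tpoly R (rset E r + rset E s)%type) :=
  [set F | exists I J : {set E},
     [/\ #|I|.+1 = r, #|J| = s.+1 & F = incidence_poly R r s S I J]]%classic.

(* Identifies the two blocks of variables, as needed when r = s and both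
   blocks are the same p_I. *)
Definition tpoly_diag (R : realType) (N : finType)
    (F : tpoly R (N + N)%type) : tpoly R N :=
  [seq (t.1, [ffun v : N => (t.2 (inl v) + t.2 (inr v))%N])
     | t : trop R * {ffun N + N -> nat} <- F].

Definition gp_polys (R : realType) (E : finType) (r : nat) :
    set (tpoly R (rset E r)) :=
  [set tpoly_diag F | F in @incidence_polys R E r r finset.set0]%classic.

(* The valuated matroids are indexed by 'I_k.+1 and the sets S_i by 'I_k, both
   starting at 0. *)
Definition Sij (E : finType) (k : nat) (S : 'I_k -> {set E}) (i j : nat) :
    {set E} :=
  \bigcup_(l : 'I_k | (i <= l < j)%N) S l.

Definition LFlDr (R : realType) (n k : nat) (r : 'I_k.+1 -> nat)
    (S : 'I_k -> {set 'I_n}) :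
    set (forall i : 'I_k.+1, tropP R (rset 'I_n (r i))) :=
  [set p |
     (forall i F, @gp_polys R 'I_n (r i) F -> hypersurface F (p i)) /\
     (forall i j : 'I_k.+1, (i < j)%N ->
      forall F, @incidence_polys R 'I_n (r i) (r j) (Sij S i j) F ->
      hypersurface2 F (p i, p j))]%classic.

(* The ground set E + {o} is [option E], with o = [None]. *)
Definition add_loop (R : realType) (E : finType) (r : nat) (mu : rfun R E r) :
    rfun R (option E) r :=
  [ffun B : rset (option E) r => if None \in val B then \oo_t
             else vm_val mu [set x | Some x \in val B]].

(* Only meaningful for surjective f. *)
Definition pullback_surj (R : realType) (D E : finType) (f : D -> E) (r : nat)
    (nu : rfun R E r) : rfun R D r :=
  [ffun I : rset D r => if is_basis nu (f @: val I) && (#|f @: val I| == #|val I|)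
             then vm_val nu (f @: val I) else \oo_t].

Lemma corestr_subproof (D E : finType) (f : D -> E) (x : D) :
  f x \notin ~: (f @: [set: D]).
Proof. by rewrite inE negbK imset_f ?inE. Qed.

Definition corestr (D E : finType) (f : D -> E) (x : D) :
    {y : E | y \notin ~: (f @: [set: D])} :=
  exist _ (f x) (corestr_subproof f x).

Definition pullback (R : realType) (D E : finType) (f : D -> E) (r : nat)
    (nu : rfun R E r) :=
  pullback_surj (corestr f) (restriction nu (f @: [set: D])).

Definition vm_morphism (R : realType) (D E : finType) (s r : nat)
    (mu : rfun R D s) (nu : rfun R E r) (f : option D -> option E) : Prop :=
  f None = None /\ vm_quotient (pullback f (add_loop nu)) (add_loop mu).

Definition pr_o (E : finType) (S : {set E}) (x : option E) : option E :=
  if x is Some e then if e \in S then None else Some e else None.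

(* Main.v *)
(* The four conditions are compared for a single pair (mu, nu) = (mu_i, mu_j)
   with S = S_ij.
   Incidence => quotient: the relation indexed by ((I u I0) - i, J u i) has a
   term attaining mu_S(I) + nu(J); another term, no larger, is the exchange.
   This works for every admissible choice of I0, so it yields both (b) and (d),
   whose definitions choose I0 independently.
   Quotient => (c): the coordinate projection maps trop(mu) into trop(mu_S), and
   every finite coordinate of a point of a tropical linear space is attained by
   a translate of a valuated cocircuit lying above the point; the incidence
   relations of (mu_S, nu) say that cocircuits of mu_S lie in trop(nu).
   (c) => incidence: valuated cocircuits of mu belong to trop(mu), by the
   exchange axiom.
   As (c) composes along the flag, the relations of non-adjacent pairs follow
   from those of adjacent pairs. *)
From HB Require Import structures.
Require Import Defs.
From mathcomp Require Import boolp classical_sets reals.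
From mathcomp Require Import all_boot all_order all_algebra lra.

Set Implicit Arguments.
Unset Strict Implicit.
Unset Printing Implicit Defensive.

Import Order.TTheory GRing.Theory Num.Theory.

(** * Arithmetic of the min-plus semiring *)

Lemma taddA (R : realType) : associative (@tadd R).
Proof. by move=> [a|] [b|] [c|] //=; rewrite addrA. Qed.

Lemma taddC (R : realType) : commutative (@tadd R).
Proof. by move=> [a|] [b|] //=; rewrite addrC. Qed.

Lemma taddCA (R : realType) : left_commutative (@tadd R).
Proof. by move=> a b c; rewrite !taddA [tadd a b]taddC. Qed.

Lemma tadd0 (R : realType) : left_id (Some 0%R) (@tadd R).
Proof. by move=> [a|] //=; rewrite add0r. Qed.

HB.instance Definition _ (R : realType) :=
  Monoid.isComLaw.Build (trop R) (Some 0%R) (@tadd R)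
    (@taddA R) (@taddC R) (@tadd0 R).

Lemma tadd_fin (R : realType) (a b : trop R) :
  (tadd a b != \oo_t) = (a != \oo_t) && (b != \oo_t).
Proof. by case: a b => [a|] [b|]. Qed.

Lemma tle_refl (R : realType) : reflexive (@tle R).
Proof. by case=> //= a; apply: lexx. Qed.

Lemma tle_trans (R : realType) : transitive (@tle R).
Proof. by move=> [b|] [a|] [c|] //=; apply: le_trans. Qed.

Lemma tle_anti (R : realType) (a b : trop R) : tle a b -> tle b a -> a = b.
Proof.
by case: a b => [a|] [b|] //= ab ba; congr Some; apply/eqP; rewrite eq_le ab ba.
Qed.

Lemma tle_fin (R : realType) (a b : trop R) :
  tle a b -> b != \oo_t -> a != \oo_t.
Proof. by case: a b => [a|] [b|]. Qed.

Lemma tle_add2r (R : realType) (c a b : trop R) :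
  tle a b -> tle (tadd a c) (tadd b c).
Proof. by case: a b c => [a|] [b|] [c|] //=; rewrite lerD2r. Qed.

Lemma tle_add2l (R : realType) (c a b : trop R) :
  tle a b -> tle (tadd c a) (tadd c b).
Proof. by rewrite ![tadd c _]taddC; apply: tle_add2r. Qed.

(** * Finite minima and tropical vanishing *)

Lemma tmin_le (R : realType) (a b : trop R) :
  tle (tmin a b) a /\ tle (tmin a b) b.
Proof.
rewrite /tmin; case: ifP => ab; rewrite ?tle_refl //; split=> //.
by case: a b ab => [a|] [b|] //=; case: ltP => // /ltW.
Qed.

Lemma bigtmin_le (R : realType) (I : eqType) (s : seq I) (h : I -> trop R) i :
  i \in s -> tle (\big[@tmin R/ \oo_t]_(j <- s) h j) (h i).
Proof.
elim: s => // j s IHs; rewrite in_cons big_cons => /predU1P[->|/IHs].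
  by have [] := tmin_le (h j) (\big[@tmin R/ \oo_t]_(j <- s) h j).
apply: tle_trans.
by have [] := tmin_le (h j) (\big[@tmin R/ \oo_t]_(j <- s) h j).
Qed.

Lemma bigtmin_attained (R : realType) (I : eqType) (s : seq I)
    (h : I -> trop R) :
  \big[@tmin R/ \oo_t]_(j <- s) h j != \oo_t ->
  exists2 i, i \in s & h i = \big[@tmin R/ \oo_t]_(j <- s) h j.
Proof.
elim: s => [|j s IHs]; first by rewrite big_nil.
rewrite big_cons /tmin; case: ifP => _ fin.
  by exists j; rewrite ?mem_head.
by have [i si eq_hi] := IHs fin; exists i; rewrite // in_cons si orbT.
Qed.

(** Comparing each finite value with a competitor avoids naming the minimum: for a value that is not
    minimal, any minimiser serves. Exempting infinite values encodes the convention that an infinite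
    minimum counts as attained twice. *)
Definition twice_min (R : realType) (I : eqType) (P : pred I)
    (h : I -> trop R) :=
  forall i, P i -> h i != \oo_t -> exists j, [/\ P j, j != i & tle (h j) (h i)].

(** Makes the condition independent of the representative chosen for a projective point. *)
Lemma twice_min_shift (R : realType) (I : eqType) (P : pred I)
    (h h' : I -> trop R) (c : R) :
  (forall i, P i -> h' i = tadd (Some c) (h i)) ->
  twice_min P h -> twice_min P h'.
Proof.
move=> eq_h' minh i Pi; rewrite eq_h' // tadd_fin /= => fin_i.
have [j [Pj ji le_ji]] := minh i Pi fin_i.
by exists j; rewrite eq_h' // tle_add2l.
Qed.

(** Of two minimisers at least one differs from any given [i]; conversely the competitor of a
    minimiser is a second minimiser. Duplicate-freeness of [s] turns a count of terms into a count
    of indices. *)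
Lemma tvanishP (R : realType) (N : finType) (I : eqType) (s : seq I)
    (F : I -> trop R * {ffun N -> nat}) (x : tspace R N) :
  uniq s ->
  tvanish [seq F i | i <- s] x <->
  twice_min (mem s) (fun i => tterm x (F i)).
Proof.
move=> uniq_s; rewrite /tvanish /teval big_map count_map.
set h := fun i => tterm x (F i); set m := \big[_/_]_(_ <- _) _.
have le_m i : i \in s -> tle m (h i) by apply: (@bigtmin_le _ _ s h).
set p := preim _ _; split.
  case=> [m_oo|count2] i si fin_i.
    by have := le_m i si; rewrite m_oo; case: (h i) fin_i.
  have /allPn[j] : ~~ all (pred1 i) (filter p s).
    apply/negP => /allP all_i; move: count2; rewrite leqNgt -size_filter ltnS.
    move/negP; apply; apply: (@uniq_leq_size _ _ [:: i]).
      exact: filter_uniq.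
    by move=> j /all_i /=; rewrite inE.
  rewrite mem_filter /= => /andP[/eqP eq_j sj] ji; exists j; split=> //.
  by rewrite [h j]eq_j le_m.
move=> minh; have [->|fin_m] := eqVneq m \oo_t; [by left|right].
have [i si eq_i] : exists2 i, i \in s & h i = m by exact: bigtmin_attained.
have [||j [/= sj ji le_ji]] := minh i => //; first by rewrite -/(h i) eq_i.
rewrite -size_filter; apply: (@uniq_leq_size _ [:: i; j]).
  by rewrite /= inE eq_sym ji.
move=> l; rewrite !inE mem_filter => /orP[] /eqP->; rewrite /= ?si ?sj andbT.
  by rewrite -/(h i) eq_i.
by apply/eqP/tle_anti; [rewrite -eq_i | apply: le_m].
Qed.

Lemma big_tpow_indicator (R : realType) (N : finType) (x : tspace R N)
    (v0 : N) (e : N -> nat) :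
  (forall v, e v = (v == v0)) ->
  \big[@tadd R/Some 0%R]_v tpow (x v) (e v) = x v0.
Proof.
move=> eq_e; rewrite (bigD1 v0) //= eq_e eqxx big1 => [|v /negPf ne_v].
  by rewrite /= Monoid.mulm1 /tpow /= taddC tadd0.
by rewrite eq_e ne_v.
Qed.

Lemma big_tpow_rset (R : realType) (E : finType) (r : nat) (x : rfun R E r)
    (A : {set E}) :
  #|A| = r ->
  \big[@tadd R/Some 0%R]_(v : rset E r) tpow (x v) (val v == A) = vm_val x A.
Proof.
move=> /eqP card_A; rewrite (@big_tpow_indicator _ _ _ (Sub A card_A)).
  by rewrite /vm_val insubT.
by move=> v; rewrite -val_eqE.
Qed.

Lemma tpowD (R : realType) (a : trop R) (m n : nat) :
  tpow a (m + n) = tadd (tpow a m) (tpow a n).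
Proof.
elim: m => [|m IHm]; first by rewrite tadd0.
by rewrite addSn /tpow /= -!/(tpow _ _) IHm taddA.
Qed.

(** * Incidence relations and the exchange property *)

Lemma vm_val_card (R : realType) (E : finType) (r : nat) (mu : rfun R E r) A :
  vm_val mu A != \oo_t -> #|A| = r.
Proof. by rewrite /vm_val; case: insubP => // B /eqP. Qed.

Lemma vm_val_rset (R : realType) (E : finType) (r : nat) (mu : rfun R E r)
    (B : rset E r) : vm_val mu (val B) = mu B.
Proof. by rewrite /vm_val valK. Qed.

Lemma vm_val_shift (R : realType) (E : finType) (r : nat) (mu nu : rfun R E r)
    (c : R) :
  (forall B, nu B = tadd (Some c) (mu B)) ->
  forall A, vm_val nu A = tadd (Some c) (vm_val mu A).
Proof. by move=> eq_nu A; rewrite /vm_val; case: insub. Qed.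

Lemma tphi_eq (R : realType) (N : finType) (x y : tvec R N) :
  tphi x = tphi y -> exists c : R, forall i, x i = tadd (Some c) (y i).
Proof. by move/eqmodP/asboolP. Qed.

(* The incidence relations of P^trop_{r,s;S;n} evaluated at (f, g). *)
Definition incident (R : realType) (E : finType) (r s : nat) (S : {set E})
    (f g : {set E} -> trop R) :=
  forall I J : {set E}, #|I|.+1 = r -> #|J| = s.+1 ->
  twice_min (mem (J :\: (I :|: S))) (fun j => tadd (f (j |: I)) (g (J :\ j))).

Lemma cardsU1D1 (E : finType) (I J : {set E}) j r s :
  #|I|.+1 = r -> #|J| = s.+1 -> j \in J -> j \notin I ->
  #|j |: I| = r /\ #|J :\ j| = s.
Proof.
move=> card_I card_J Jj Ij; rewrite cardsU1 Ij add1n; split=> //.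
by move: card_J; rewrite (cardsD1 j) Jj add1n => -[].
Qed.

Lemma tvanish_incidence (R : realType) (E : finType) (r s : nat)
    (S I J : {set E}) (x : rfun R E r) (y : rfun R E s) :
  #|I|.+1 = r -> #|J| = s.+1 ->
  tvanish (incidence_poly R r s S I J) (tjoin x y) <->
  twice_min (mem (J :\: (I :|: S)))
    (fun j => tadd (vm_val x (j |: I)) (vm_val y (J :\ j))).
Proof.
move=> card_I card_J.
have eq_term j : j \in J :\: (I :|: S) ->
    tterm (tjoin x y) (Some 0%R, [ffun v : rset E r + rset E s =>
      match v with inl A => nat_of_bool (val A == j |: I)
      | inr B => nat_of_bool (val B == J :\ j) end]) =
    tadd (vm_val x (j |: I)) (vm_val y (J :\ j)).
  rewrite !inE negb_or => /andP[/andP[Ij _] Jj].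
  have [card_Ij card_Jj] := cardsU1D1 card_I card_J Jj Ij.
  rewrite /tterm tadd0 big_sumType /= -(big_tpow_rset x card_Ij).
  rewrite -(big_tpow_rset y card_Jj).
  by congr tadd; apply: eq_bigr => v _; rewrite !ffunE.
rewrite /incidence_poly tvanishP ?enum_uniq //.
split=> min i; rewrite /= ?mem_enum => Pi.
  rewrite -eq_term // => fin_i.
  have [|//|j [/= Pj ji le_ji]] := min i; first by rewrite /= mem_enum.
  rewrite mem_enum in Pj.
  by exists j; rewrite -eq_term.
rewrite eq_term // => fin_i; have [|//|j [/= Pj ji le_ji]] := min i => //.
by exists j; rewrite /= mem_enum eq_term.
Qed.

Lemma hypersurface2_incidence (R : realType) (E : finType) (r s : nat)
    (S : {set E}) (mu : tvec R (rset E r)) (nu : tvec R (rset E s)) :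
  (forall F, @incidence_polys R E r s S F ->
     hypersurface2 F (tphi mu, tphi nu)) <->
  incident r s S (vm_val mu) (vm_val nu).
Proof.
split=> [hyp I J card_I card_J|inc _ [I [J [card_I card_J ->]]]].
  have [|x [y [[/tphi_eq[c eq_mu] /tphi_eq[d eq_nu]]]]] :=
    hyp (incidence_poly R r s S I J); first by exists I, J.
  (* The two blocks are rescaled independently, by [c] and [d]; each term has one variable from each
     block, so all terms shift by [c + d]. *)
  rewrite tvanish_incidence //; apply: (@twice_min_shift _ _ _ _ _ (c + d)%R).
  move=> j _; rewrite (vm_val_shift eq_mu) (vm_val_shift eq_nu).
  by rewrite -[Some (c + d)%R]/(tadd (Some c) (Some d)) Monoid.mulmACA.
by exists mu, nu; split; rewrite // tvanish_incidence //; apply: inc.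
Qed.

(** Quantifying over sets of finite value leaves cardinalities implicit, so the notion also applies
    to set functions such as [del S I0 f] that are not given as an [rfun]. *)
Definition exchange (R : realType) (E : finType) (f g : {set E} -> trop R) :=
  forall I J : {set E}, f I != \oo_t -> g J != \oo_t ->
  forall i, i \in I :\: J -> exists2 j, j \in J :\: I &
    tle (tadd (f (j |: (I :\ i))) (g (i |: (J :\ j)))) (tadd (f I) (g J)).

Lemma vm_exchange (R : realType) (E : finType) (r : nat) (mu : rfun R E r) :
  valuated_matroid mu -> exchange (vm_val mu) (vm_val mu).
Proof. by case=> _ exch I J /vm_val_card cI /vm_val_card cJ; apply: exch. Qed.

Lemma vm_quotientP (R : realType) (E : finType) (r s : nat)
    (mu : rfun R E r) (nu : rfun R E s) :
  vm_quotient mu nu <-> (r <= s)%N /\ exchange (vm_val mu) (vm_val nu).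
Proof.
split=> -[rs exch]; split=> // I J cI cJ i IJi.
  by apply: exch => //; apply: vm_val_card; eassumption.
have [fin|] := boolP (tadd (vm_val mu I) (vm_val nu J) != \oo_t).
  by move: fin; rewrite tadd_fin => /andP[fI gJ]; apply: exch.
rewrite negbK => /eqP->.
(* The right-hand side being infinite, any [j] in [J :\: I] will do; one exists because [r <= s] and
   [I :\: J] is nonempty. *)
suff /card_gt0P[j JIj] : (0 < #|J :\: I|)%N.
  by exists j => //; case: tadd.
have : (0 < #|I :\: J|)%N by apply/card_gt0P; exists i.
rewrite !cardsD setIC subn_gt0 => lt_I.
by rewrite subn_gt0 cJ (leq_trans _ rs) // -cI.
Qed.

(** Exchanging [i] between [i |: I] and [J :\ i] for some [j] produces [j |: I] and [J :\ j], which
    is another term of the relation of [I] and [J]. *)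
Lemma exchange_incident (R : realType) (E : finType) (r s : nat)
    (f g : {set E} -> trop R) :
  exchange f g -> incident r s set0 f g.
Proof.
move=> exch I J card_I card_J i /=.
rewrite setU0 inE => /andP[Ii Ji]; rewrite tadd_fin => /andP[fI gJ].
have [|j] := exch _ _ fI gJ i; first by rewrite !inE !eqxx.
rewrite !inE negb_or => /andP[/andP[ji Ij] /andP[_ Jj]] le_ji.
exists j; rewrite ji !inE Ij Jj; split=> //; move: le_ji.
rewrite setU1K // (_ : i |: (J :\ i) :\ j = J :\ j) //.
apply/setP=> l; rewrite !inE; have [->|_ //] := eqVneq l i.
by rewrite eq_sym ji Ji.
Qed.

(** * Tropical linear spaces and cocircuits *)

Definition to_tvec (R : realType) (N : finType) (x : tspace R N)
    (x_fin : x != tinf R N) : tvec R N :=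
  exist (fun y : tspace R N => y != tinf R N) x x_fin.

(* x satisfies the linear equations of all valuated circuits of f. *)
Definition in_trop_linear (R : realType) (E : finType) (r : nat)
    (f : {set E} -> trop R) (x : tspace R E) :=
  forall I : {set E}, #|I| = r.+1 ->
  twice_min (mem I) (fun i => tadd (f (I :\ i)) (x i)).

Lemma tvanish_linear_form (R : realType) (E : finType) (C x : tspace R E) :
  tvanish (linear_form C) x <-> twice_min predT (fun i => tadd (C i) (x i)).
Proof.
have eq_term i :
    tterm x (C i, [ffun l => nat_of_bool (l == i)]) = tadd (C i) (x i).
  rewrite /tterm /=; congr tadd.
  by apply: big_tpow_indicator => v; rewrite ffunE.
rewrite /linear_form tvanishP ?enum_uniq //.
split=> min i _; rewrite ?eq_term => fin_i.
  have [||j [_ ji]] := min i; rewrite ?eq_term /= ?mem_enum // => le_ji.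
  by exists j.
have [||j [_ ji le_ji]] := min i => //.
by exists j; rewrite eq_term /= mem_enum.
Qed.

Lemma trop_linearP (R : realType) (E : finType) (r : nat) (mu : rfun R E r)
    (x : tvec R E) :
  trop_linear mu (tphi x) <-> in_trop_linear r (vm_val mu) x.
Proof.
split=> [trop_x I card_I|lin_x _ [C [I [card_I eq_C]] <-]].
  (* An identically infinite circuit vector defines no projective point, and its equation has only
     infinite terms. *)
  have [C_oo|C_fin] := eqVneq (circuit_vec mu I) (tinf R E).
    move=> i /= Ii; rewrite tadd_fin.
    by move/ffunP/(_ i): C_oo; rewrite !ffunE Ii => ->.
  pose C := to_tvec C_fin.
  have [|y lin_y /tphi_eq[c eq_y]] := trop_x (tphi C).
    by exists C => //; exists I.
  (* [repr] picks its own representative, off by [d], and [y] differs from [x] by [c]; both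
     constants cancel in comparisons. *)
  have [d eq_C] : exists d : R, forall i, repr (tphi C) i = tadd (Some d) (C i).
    by apply: tphi_eq; rewrite /tphi reprK.
  move: lin_y => /tvanish_linear_form lin_y i /= Ii fin_i.
  have eq_sum j : j \in I -> tadd (repr (tphi C) j) (y j) =
      tadd (Some (d + c)%R) (tadd (vm_val mu (I :\ j)) (x j)).
    move=> Ij; rewrite eq_C eq_y (_ : C j = vm_val mu (I :\ j)) ?ffunE ?Ij //.
    by rewrite -[Some (d + c)%R]/(tadd (Some d) (Some c)) Monoid.mulmACA.
  have fin_i' : tadd (repr (tphi C) i) (y i) != \oo_t.
    by rewrite eq_sum // tadd_fin.
  have [j [_ ji le_ji]] := lin_y i isT fin_i'.
  have Ij : j \in I.
    apply: contraTT (tle_fin le_ji fin_i') => Ij.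
    by rewrite eq_C /= ffunE (negPf Ij).
  exists j; split=> //; move: le_ji; rewrite !eq_sum //.
  move/(tle_add2l (Some (- (d + c))%R)).
  by rewrite !taddA -[tadd (Some (- _)%R) _]/(Some (- (d + c) + (d + c))%R)
             addNr !tadd0.
have [d eq_rC] : exists d : R, forall i, repr (tphi C) i = tadd (Some d) (C i).
  by apply: tphi_eq; rewrite /tphi reprK.
exists x => //; apply/tvanish_linear_form.
apply: (@twice_min_shift _ _ _ (fun i => tadd (circuit_vec mu I i) (x i)) _ d).
  by move=> i _; rewrite eq_rC eq_C taddA.
move=> i _; rewrite ffunE; case: ifP => // Ii fin_i.
have [j [/= Ij ji le_ji]] := lin_x I card_I i Ii fin_i.
by exists j; rewrite ffunE Ij.
Qed.

Lemma in_trop_linear_oo (R : realType) (E : finType) (r : nat)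
    (f : {set E} -> trop R) (x : tspace R E) :
  x = tinf R E -> in_trop_linear r f x.
Proof. by move=> -> I _ i _; rewrite ffunE taddC. Qed.

(** Turns the projective inclusion into a statement on affine vectors, which composes along the
    flag. The all-infinite vector, dropped by [tprP], satisfies every circuit equation. *)
Lemma tprP_trop_linear (R : realType) (E : finType) (r s : nat) (S : {set E})
    (mu : rfun R E r) (nu : rfun R E s) :
  (tprP S (trop_linear mu) `<=` trop_linear nu)%classic <->
  (forall x, in_trop_linear r (vm_val mu) x ->
     in_trop_linear s (vm_val nu) (tpr S x)).
Proof.
split=> [sub x lin_x|sub _ [y [x /trop_linearP lin_x eq_y] <-]]; last first.
  by apply/trop_linearP; rewrite eq_y; apply: sub.
have [Sx_oo|Sx_fin] := eqVneq (tpr S x) (tinf R E).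
  exact: in_trop_linear_oo.
have x_fin : x != tinf R E.
  apply: contraNneq Sx_fin => ->; apply/eqP/ffunP=> i.
  by rewrite !ffunE; case: ifP.
apply/(trop_linearP nu (to_tvec Sx_fin))/sub.
exists (to_tvec Sx_fin) => //; exists (to_tvec x_fin) => //.
exact/trop_linearP.
Qed.

(* Subject to |B :&: Z| being maximal, where Z is the set of infinite
   coordinates of x, choose B minimizing f B - x(B :\: Z); the circuit equation
   of j0 |: B lets us swap j0 into B, and then I := B :\ j0. *)
Lemma in_trop_linear_cocircuit (R : realType) (E : finType) (r : nat)
    (f : {set E} -> trop R) (x : tspace R E) (j0 : E) :
  (forall B, f B != \oo_t -> #|B| = r) -> (exists B, f B != \oo_t) ->
  in_trop_linear r f x -> x j0 != \oo_t ->
  exists (I : {set E}) (c : R),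
    [/\ #|I|.+1 = r, j0 \notin I, x j0 = tadd (Some c) (f (j0 |: I))
      & forall j, tle (x j) (tadd (Some c) (f (j |: I)))].
Proof.
move=> card_f [B0 fB0] lin_x x_j0.
pose Z := [set j | x j == \oo_t]; pose val_or0 (a : trop R) := odflt 0%R a.
case: (@arg_maxnP _ B0 (fun B => f B != \oo_t) (fun B => #|B :&: Z|) fB0).
move=> B1 fB1 maxZ.
pose P := [pred B | (f B != \oo_t) && (#|B :&: Z| == #|B1 :&: Z|)].
(* Infinite coordinates count as 0, so the sum effectively runs over [B] outside [Z]; [f B] is
   finite whenever [P B] holds. *)
pose w B : R := (val_or0 (f B) - \sum_(b in B) val_or0 (x b))%R.
have PB1 : P B1 by rewrite /= fB1 eqxx.
case: (@arg_minP _ _ _ B1 P w PB1) => B2 PB2 minw.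
have [B PB [minB Bj0]] : exists2 B, P B &
    (forall B', P B' -> (w B <= w B')%R) /\ j0 \in B.
  have [Bj0|Bj0] := boolP (j0 \in B2); first by exists B2.
  have /andP[fB2 /eqP Z2] := PB2.
  have card_B2 : #|j0 |: B2| = r.+1 by rewrite cardsU1 Bj0 (card_f _ fB2).
  (* The competitor [j] has finite [x j], so replacing it by [j0] keeps the intersection with [Z];
     its inequality says that [w] does not increase. *)
  have [||j [/= + jj0]] := lin_x _ card_B2 j0; first exact: setU11.
    by rewrite setU1K // tadd_fin fB2.
  rewrite setU1K // !inE (negPf jj0) /= => B2j le_j.
  have /andP[fB xj] : (f ((j0 |: B2) :\ j) != \oo_t) && (x j != \oo_t).
    by rewrite -tadd_fin (tle_fin le_j) // tadd_fin fB2.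
  have eq_Z : ((j0 |: B2) :\ j) :&: Z = B2 :&: Z.
    apply/setP=> l; rewrite !inE; have [->|_] := eqVneq l j.
      by rewrite (negPf xj) !andbF.
    by have [->|//] := eqVneq l j0; rewrite (negPf x_j0) !andbF.
  exists ((j0 |: B2) :\ j); first by rewrite /= fB eq_Z Z2 eqxx.
  rewrite !inE eq_sym jj0 eqxx; split=> // B' /minw; apply: le_trans.
  move: le_j; rewrite /w.
  have : (\sum_(b in j0 |: B2) val_or0 (x b) =
      val_or0 (x j) + \sum_(b in (j0 |: B2) :\ j) val_or0 (x b))%R.
    by rewrite (big_setD1 j) //= !inE B2j orbT.
  rewrite big_setU1 //=.
  case: (f (_ :\ j)) (f B2) (x j) (x j0) fB fB2 xj x_j0
    => [a|] [b|] [c|] [d|] //= _ _ _ _.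
  move: (\sum_(b in B2) val_or0 (x b))%R
    (\sum_(b in (j0 |: B2) :\ j) val_or0 (x b))%R => s1 s2 eq_s le_s.
  have -> : s2 = (d + s1 - c)%R by rewrite eq_s addrC addKr.
  lra.
have /andP[fB /eqP ZB] := PB.
have eq_B : j0 |: (B :\ j0) = B by rewrite setD1K.
(* The constant is forced by equality at [j0]; minimality of [w B] against [j |: (B :\ j0)] then
   gives the inequality at the other [j] where both sides are finite. *)
exists (B :\ j0), (val_or0 (x j0) - val_or0 (f B))%R; split.
- by rewrite -(card_f _ fB) (cardsD1 j0 B) Bj0.
- by rewrite !inE eqxx.
- rewrite eq_B; case: (x j0) (f B) x_j0 fB => // a [] //= b _ _.
  by rewrite subrK.
move=> j; have [->|jj0] := eqVneq j j0.
  rewrite eq_B; case: (x j0) (f B) x_j0 fB => // a [] //= b _ _.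
  by rewrite subrK.
have [->|fin_j] := eqVneq (f (j |: (B :\ j0))) \oo_t.
  by rewrite taddC; case: (x j).
have Bj : j \notin B.
  apply: contraL (eqxx r) => Bj.
  rewrite -{1}(card_f _ fin_j) -(card_f _ fB) cardsU1 !inE jj0 Bj /=.
  by rewrite (cardsD1 j0 B) Bj0 neq_ltn ltnSn.
have eq_Z : (B :\ j0) :&: Z = B :&: Z.
  apply/setP=> l; rewrite !inE; have [->|//] := eqVneq l j0.
  by rewrite (negPf x_j0) !andbF.
(* For [j] in [Z] the basis [j |: (B :\ j0)] would meet [Z] in one more element, contradicting
   [maxZ]: [j0], having a finite coordinate, is not in [Z]. *)
have [xj|xj] := boolP (x j == \oo_t).
  have := maxZ _ fin_j; rewrite setIUl eq_Z -ZB.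
  rewrite (_ : [set j] :&: Z = [set j]); last first.
    by apply/setIidPl; rewrite sub1set inE.
  by rewrite cardsU1 inE (negPf Bj) /= add1n /= ltnn.
have /minB : P (j |: B :\ j0).
  rewrite /= fin_j setIUl eq_Z -ZB (_ : [set j] :&: Z = set0).
    by rewrite set0U eqxx.
  by apply/setP=> l; rewrite !inE; case: eqVneq => // ->; apply/negbTE.
rewrite /w (big_setD1 j0 Bj0) big_setU1 ?inE ?(negPf Bj) ?andbF //=.
case: (x j) (x j0) (f B) (f (_ |: _)) xj x_j0 fB fin_j
  => [a|] [b|] [c|] [d|] //= _ _ _ _.
move: (\sum_(b in B :\ j0) val_or0 (x b))%R => s1.
lra.
Qed.

(** * Incidence relations versus inclusion of linear spaces *)

(** The cocircuit vector of [I], shifted by [c], lies above [x] and touches it at [j0]. Hence a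
    competitor of [j0] in the incidence relation of [I] and [J] also competes in the circuit
    equation of [x]; it survives [tpr S] because the relation omits [S]. *)
Lemma incident_trop_linear (R : realType) (E : finType) (r s : nat)
    (S : {set E}) (f g : {set E} -> trop R) (x : tspace R E) :
  (forall B, f B != \oo_t -> #|B| = r) -> (exists B, f B != \oo_t) ->
  incident r s S f g -> in_trop_linear r f x -> in_trop_linear s g (tpr S x).
Proof.
move=> card_f f_fin inc lin_x J card_J j0 /= Jj0.
rewrite tadd_fin ffunE => /andP[g_fin]; case: ifPn => // Sj0 x_fin.
have [I [c [card_I Ij0 eq_x le_x]]] :=
  in_trop_linear_cocircuit card_f f_fin lin_x x_fin.
have [||j []] := inc I J card_I card_J j0.
- by rewrite /= !inE negb_or Ij0 Sj0.
- by move: x_fin; rewrite eq_x !tadd_fin g_fin andbT.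
rewrite /= !inE negb_or => /andP[/andP[Ij Sj] Jj] jj0 le_j.
exists j; split=> //; rewrite ffunE (negPf Sj).
apply: tle_trans (tle_add2l _ (le_x j)) _; rewrite eq_x.
rewrite [tadd (g _) _]taddCA [tadd _ (tadd _ (f (j0 |: I)))]taddCA.
by apply: tle_add2l; rewrite taddC [tadd (g (J :\ j0)) _]taddC.
Qed.

(** The vector with coordinates [f (j |: I)] solves the circuit equations of [f] by exchange. The
    circuit equation of its projection at [J] is the incidence relation of [I] and [J]: indices in
    [I] or [S] contribute infinite terms. *)
Lemma trop_linear_incident (R : realType) (E : finType) (r s : nat)
    (S : {set E}) (f g : {set E} -> trop R) :
  (forall B, f B != \oo_t -> #|B| = r) -> exchange f f ->
  (forall x, in_trop_linear r f x -> in_trop_linear s g (tpr S x)) ->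
  incident r s S f g.
Proof.
move=> card_f exch_f sub I J card_I card_J.
have fin_notin i : f (i |: I) != \oo_t -> i \notin I.
  move=> fin_i; apply/negP => Ii; apply: (n_Sn #|I|).
  by rewrite card_I -(card_f _ fin_i) cardsU1 Ii.
have /sub lin_I : in_trop_linear r f [ffun j => f (j |: I)].
  move=> K card_K i /= Ki; rewrite ffunE taddC => fin_i.
  have Ii : i \notin I by move: fin_i; rewrite tadd_fin => /andP[/fin_notin].
  have [||j [/=]] := exchange_incident exch_f card_I card_K (i := i) => //.
    by rewrite /= !inE orbF Ii.
  rewrite !inE => /andP[_ Kj] ji le_j.
  by exists j; rewrite ffunE taddC.
move=> i /=; rewrite !inE negb_or => /andP[/andP[Ii Si] Ji] fin_i.
have [||j [/= Jj ji]] := lin_I J card_J i => //.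
  by rewrite !ffunE (negPf Si) taddC.
rewrite !ffunE (negPf Si) taddC [tadd (g (J :\ i)) _]taddC => le_j.
have := tle_fin le_j fin_i; rewrite tadd_fin; case: ifPn => //= Sj.
move=> /andP[/fin_notin Ij _]; exists j; rewrite !inE negb_or Ij Sj.
by split=> //; move: le_j; rewrite (negPf Sj).
Qed.

(** * Deletion and its linear space *)

(* The set function of mu_S when the subset I of S in its definition is I0. *)
Definition del (R : realType) (E : finType) (S I0 : {set E})
    (f : {set E} -> trop R) (B : {set E}) : trop R :=
  if [disjoint B & S] then f (B :|: I0) else \oo_t.

(** Common to the choices of [I0] made by [loop_deletion] and by the pullback. When bases have [r]
    elements, the last two conditions pin [k] down as the rank of [~: S]: a basis inside
    [~: S :|: I0] has at least [r - #|I0|], that is [k], elements outside [S]. *)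
Definition del_witness (R : realType) (E : finType) (r k : nat)
    (S I0 : {set E}) (f : {set E} -> trop R) :=
  [/\ k <= r, I0 \subset S, #|I0| = r - k,
      forall B, f B != \oo_t -> #|~: S :&: B| <= k
    & exists2 B, f B != \oo_t & B \subset ~: S :|: I0]%N.

Lemma del_fin (R : realType) (E : finType) (S I0 : {set E})
    (f : {set E} -> trop R) (B : {set E}) :
  (del S I0 f B != \oo_t) = [disjoint B & S] && (f (B :|: I0) != \oo_t).
Proof. by rewrite /del; case: ifP. Qed.

Lemma disjoint_notin (E : finType) (A S : {set E}) i :
  [disjoint A & S] -> i \in A -> i \notin S.
Proof. by move=> dis Ai; rewrite (disjointFr dis Ai). Qed.

Lemma disjoint_setU1 (E : finType) (A S : {set E}) i :
  [disjoint i |: A & S] = (i \notin S) && [disjoint A & S].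
Proof. by rewrite -!setI_eq0 setIUl setU_eq0 !setI_eq0 disjoints1. Qed.

Lemma card_disjointU (E : finType) (B S I0 : {set E}) :
  [disjoint B & S] -> I0 \subset S -> #|B :|: I0| = (#|B| + #|I0|)%N.
Proof.
move=> dis sub; rewrite cardsU (_ : B :&: I0 = set0) ?cards0 ?subn0 //.
by apply/eqP; rewrite setI_eq0; apply: disjointWr dis.
Qed.

Lemma card_del (R : realType) (E : finType) (r k : nat) (S I0 : {set E})
    (f : {set E} -> trop R) :
  (forall B, f B != \oo_t -> #|B| = r) -> del_witness r k S I0 f ->
  forall B, del S I0 f B != \oo_t -> #|B| = k.
Proof.
move=> card_f [kr sub card_I0 _ _] B; rewrite del_fin => /andP[dis /card_f].
rewrite (card_disjointU dis sub) card_I0 => card_B.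
by apply/eqP; rewrite -(eqn_add2r (r - k)) card_B subnKC.
Qed.

(** A basis inside [~: S :|: I0] has at most [k] elements outside [S], so it must contain all
    [r - k] elements of [I0]; removing them leaves the required set. *)
Lemma del_nonempty (R : realType) (E : finType) (r k : nat) (S I0 : {set E})
    (f : {set E} -> trop R) :
  (forall B, f B != \oo_t -> #|B| = r) -> del_witness r k S I0 f ->
  exists B, del S I0 f B != \oo_t.
Proof.
move=> card_f [kr sub card_I0 rk_le [B fB subB]].
have subI0 : I0 \subset B.
  suff /eqP <- : B :&: I0 == I0 by apply: subsetIl.
  rewrite eqEcard subsetIr card_I0 leq_subLR -{1}(card_f _ fB).
  apply: leq_trans (leq_add (rk_le _ fB) (leqnn _)).
  rewrite -(cardsID (~: S) B) setIC leq_add2l subset_leq_card //.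
  apply/subsetP=> i; rewrite !inE negbK => /andP[Si Bi].
  by have := subsetP subB i Bi; rewrite !inE Si Bi.
have eq_B : B :\: I0 :|: I0 = B.
  apply/setP=> i; rewrite !inE.
  case: (boolP (i \in I0)) => [/(subsetP subI0)->|] //.
  by rewrite orbF.
exists (B :\: I0); rewrite del_fin eq_B fB andbT.
rewrite disjoint_subset; apply/subsetP=> i; rewrite !inE => /andP[I0i Bi].
by have := subsetP subB i Bi; rewrite !inE (negPf I0i) orbF.
Qed.

Lemma incident_exchange_del (R : realType) (E : finType) (r s : nat)
    (S I0 : {set E}) (f g : {set E} -> trop R) :
  (forall B, f B != \oo_t -> #|B| = r) ->
  (forall B, g B != \oo_t -> #|B| = s) ->
  I0 \subset S -> incident r s S f g -> exchange (del S I0 f) g.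
Proof.
move=> card_f card_g sub inc I J; rewrite del_fin => /andP[dis fI] gJ i.
rewrite inE => /andP[Ji Ii]; have Si := disjoint_notin dis Ii.
have I0i : i \notin I0 by apply: contra Si; apply: (subsetP sub).
have II0i : i \in I :|: I0 by rewrite inE Ii.
have card_I : #|(I :|: I0) :\ i|.+1 = r.
  by rewrite -(card_f _ fI) (cardsD1 i (I :|: I0)) II0i.
have card_J : #|i |: J| = s.+1 by rewrite cardsU1 Ji (card_g _ gJ).
(* The term at [i] is the right-hand side of the exchange inequality. The competitor [j] avoids [S],
   so exchanging it preserves disjointness from [S]. *)
have [||j [/=]] := inc _ _ card_I card_J i.
- by rewrite /= !inE eqxx (negPf Si).
- by rewrite setD1K // setU1K // tadd_fin fI.
rewrite !inE !negb_or negb_and negbK.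
move=> /andP[/andP[/orP[->//|/norP[Ij I0j]] Sj]].
move=> + ji; rewrite (negPf ji) /= => Jj le_j.
exists j; first by rewrite !inE Ij.
have disj : [disjoint j |: (I :\ i) & S].
  by rewrite disjoint_setU1 // Sj; apply: disjointWl dis; apply: subD1set.
rewrite /del disj dis; move: le_j; rewrite setD1K // setU1K //.
congr (tle (tadd (f _) (g _)) _); apply/setP=> l; rewrite !inE.
  have [//|_ /=] := eqVneq l j; have [->|//] := eqVneq l i.
  by rewrite (negPf I0i).
by have [->|_ //] := eqVneq l i; rewrite eq_sym ji.
Qed.

(** The circuit equation of [f] at [K :|: I0] restricts to that of the deletion at [K]. Its
    competitor cannot be in [I0]: otherwise a basis would contain [K], which has [k + 1] elements
    outside [S]. *)
Lemma in_trop_linear_del (R : realType) (E : finType) (r k : nat)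
    (S I0 : {set E}) (f : {set E} -> trop R) (x : tspace R E) :
  del_witness r k S I0 f -> in_trop_linear r f x ->
  in_trop_linear k (del S I0 f) (tpr S x).
Proof.
move=> [kr sub card_I0 rk_le _] lin_x K card_K i /= Ki.
rewrite tadd_fin del_fin ffunE => /andP[/andP[dis fK]].
case: ifPn => // Si xi.
have disK : [disjoint K & S] by rewrite -(setD1K Ki) disjoint_setU1 Si.
have I0i : i \notin I0 by apply: contra Si; apply: (subsetP sub).
have card_KI : #|K :|: I0| = r.+1.
  by rewrite (card_disjointU disK sub) card_K card_I0 addSn subnKC.
have KI_i : i \in K :|: I0 by rewrite inE Ki.
have eq_D l : l \notin I0 -> (K :|: I0) :\ l = K :\ l :|: I0.
  move=> I0l; apply/setP=> m; rewrite !inE.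
  by have [->|//] := eqVneq m l; rewrite (negPf I0l).
have fin_i : tadd (f ((K :|: I0) :\ i)) (x i) != \oo_t.
  by rewrite eq_D // tadd_fin fK.
have [j [/= KIj ji le_j]] := lin_x _ card_KI i KI_i fin_i.
have /andP[fj _] : (f ((K :|: I0) :\ j) != \oo_t) && (x j != \oo_t).
  by rewrite -tadd_fin (tle_fin le_j).
have I0j : j \notin I0.
  apply/negP => I0j; have := rk_le _ fj; rewrite leqNgt -card_K => /negP; apply.
  apply/subset_leq_card/subsetP=> l Kl; have Sl := disjoint_notin disK Kl.
  rewrite !inE Sl Kl /= andbT; apply: contraNneq Sl => ->.
  exact: (subsetP sub).
have Kj : j \in K by move: KIj; rewrite inE (negPf I0j) orbF.
exists j; split=> //; have disD l : [disjoint K :\ l & S].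
  by apply: disjointWl disK; apply: subD1set.
rewrite ffunE (negPf (disjoint_notin disK Kj)) /del !disD.
by move: le_j; rewrite !eq_D.
Qed.

Lemma tpr_comp (R : realType) (E : finType) (S T : {set E}) (x : tspace R E) :
  tpr S (tpr T x) = tpr (T :|: S) x.
Proof. by apply/ffunP=> i; rewrite !ffunE inE; do 2!case: (_ \in _). Qed.

Lemma tpr0 (R : realType) (E : finType) (x : tspace R E) :
  tpr set0 x = x.
Proof. by apply/ffunP=> i; rewrite !ffunE inE. Qed.

Lemma exchange_del_trop_linear (R : realType) (E : finType) (r s k : nat)
    (S I0 : {set E}) (f g : {set E} -> trop R) :
  (forall B, f B != \oo_t -> #|B| = r) -> del_witness r k S I0 f ->
  exchange (del S I0 f) g ->
  forall x, in_trop_linear r f x -> in_trop_linear s g (tpr S x).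
Proof.
(* The deletion has absorbed [S], so the incidence relations with the empty set are applied to the
   vector [tpr S x]. *)
move=> card_f wit exch x lin_x; rewrite -(tpr0 (tpr S x)).
apply: (@incident_trop_linear _ _ k s _ (del S I0 f)).
- exact: (card_del card_f wit).
- exact: (del_nonempty card_f wit).
- exact: exchange_incident.
- exact: in_trop_linear_del wit lin_x.
Qed.

Lemma del_ext_witness (R : realType) (E : finType) (r : nat) (mu : rfun R E r)
    (S : {set E}) :
  (exists B, mu B != \oo_t) ->
  del_witness r (mrank mu (~: S)) S (del_ext mu S) (vm_val mu).
Proof.
case=> B0; rewrite -vm_val_rset => mu_B0.
have rank_le A : (mrank mu A <= r)%N.
  apply/bigmax_leqP => B /vm_val_card <-; apply: subset_leq_card.
  exact: subsetIr.
have rank_attained A : exists2 B, is_basis mu B & mrank mu A = #|A :&: B|.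
  have [|B Bb rk] := @eq_bigmax_cond _ (is_basis mu) (fun B => #|A :&: B|).
    by apply/card_gt0P; exists (val B0).
  by exists B; last exact: rk.
have le_rank A B : is_basis mu B -> (#|A :&: B| <= mrank mu A)%N.
  by move=> Bb; apply: leq_bigmax_cond.
suff [sub card_I rk] : [/\ del_ext mu S \subset S,
    #|del_ext mu S| = (r - mrank mu (~: S))%N
    & mrank mu (~: S :|: del_ext mu S) = r].
  split=> // [B Bb|]; first exact: le_rank.
  have [B Bb eq_rk] := rank_attained (~: S :|: del_ext mu S); exists B => //.
  have : (~: S :|: del_ext mu S) :&: B == B.
    by rewrite eqEcard subsetIr -eq_rk (vm_val_card Bb) rk /=.
  by move/eqP=> <-; apply: subsetIl.
rewrite /del_ext; case: pickP => [I0 /and3P[? /eqP ? /eqP]|] //= noI.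
have [B Bb rk] := rank_attained (~: S).
have := noI (B :&: S); rewrite subsetIr /= => /negP[]; apply/andP; split.
  rewrite rk -(vm_val_card Bb) -(cardsID S B).
  by rewrite [~: S :&: B]setIC -setDE addnK.
rewrite eqn_leq rank_le /= -{1}(vm_val_card Bb).
apply: leq_trans (le_rank _ _ Bb); apply/subset_leq_card/subsetP=> i Bi.
by rewrite !inE Bi /=; case: (i \in S).
Qed.

Lemma loop_deletion_val (R : realType) (E : finType) (r : nat)
    (mu : rfun R E r) (S B : {set E}) :
  (exists B, mu B != \oo_t) ->
  vm_val (loop_deletion mu S) B = del S (del_ext mu S) (vm_val mu) B.
Proof.
move=> mu_fin; rewrite {1}/vm_val; case: insubP => [B' _ eq_B|card_B].
  by rewrite ffunE eq_B.
apply/esym/eqP; apply: contraNT card_B => fin_B; apply/eqP.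
by apply: card_del fin_B; [apply: vm_val_card | apply: del_ext_witness].
Qed.

(** * Added loops and pullback along projections *)

Definition loop_ext (R : realType) (E : finType) (f : {set E} -> trop R)
    (A : {set option E}) : trop R :=
  if None \in A then \oo_t else f [set x | Some x \in A].

Lemma mem_Some_imset (E : finType) (B : {set E}) x :
  (Some x \in Some @: B) = (x \in B).
Proof. by rewrite mem_imset //; apply: Some_inj. Qed.

Lemma None_Some_imset (E : finType) (B : {set E}) : None \notin Some @: B.
Proof. by apply/imsetP=> -[]. Qed.

Lemma Some_preimsetK (E : finType) (B : {set E}) :
  [set x | Some x \in Some @: B] = B.
Proof. by apply/setP=> x; rewrite inE mem_Some_imset. Qed.

Lemma Some_imset_preim (E : finType) (A : {set option E}) :
  None \notin A -> Some @: [set x | Some x \in A] = A.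
Proof.
move=> A_None; apply/setP=> -[x|]; first by rewrite mem_Some_imset inE.
by rewrite (negPf A_None) (negPf (None_Some_imset _)).
Qed.

Lemma card_Some_imset (E : finType) (B : {set E}) : #|Some @: B| = #|B|.
Proof. by rewrite card_imset //; apply: Some_inj. Qed.

Lemma loop_ext_Some (R : realType) (E : finType) (f : {set E} -> trop R)
    (B : {set E}) :
  loop_ext f (Some @: B) = f B.
Proof. by rewrite /loop_ext (negPf (None_Some_imset B)) Some_preimsetK. Qed.

Lemma loop_ext_fin (R : realType) (E : finType) (f : {set E} -> trop R) A :
  loop_ext f A != \oo_t -> exists2 B : {set E}, A = Some @: B & f B != \oo_t.
Proof.
rewrite /loop_ext; case: ifPn => // A_None fin.
by exists [set x | Some x \in A]; rewrite ?Some_imset_preim.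
Qed.

(** Sets of finite value are images of subsets of [E], so the loop never takes part in an
    exchange. *)
Lemma exchange_loop_ext (R : realType) (E : finType)
    (f g : {set E} -> trop R) :
  exchange (loop_ext f) (loop_ext g) <-> exchange f g.
Proof.
have swap (A : {set E}) i j :
    Some j |: (Some @: A :\ Some i) = Some @: (j |: (A :\ i)).
  apply/setP=> -[l|]; last by rewrite !inE !(negPf (None_Some_imset _)).
  by rewrite mem_Some_imset !inE mem_Some_imset.
split=> [exch I J fI gJ i IJi|exch I' J'].
  have [|||j'] := exch (Some @: I) (Some @: J) _ _ (Some i).
  - by rewrite loop_ext_Some.
  - by rewrite loop_ext_Some.
  - by rewrite inE !mem_Some_imset -in_setD.
  rewrite inE => /andP[Ij /imsetP[j Jj eq_j]]; move: Ij; rewrite eq_j.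
  rewrite !swap !loop_ext_Some mem_Some_imset => Ij le_j.
  by exists j; rewrite // inE Ij.
move=> /loop_ext_fin[I -> fI] /loop_ext_fin[J -> gJ] i'.
rewrite inE => /andP[Ji /imsetP[i Ii eq_i]].
move: Ji; rewrite eq_i mem_Some_imset => Ji.
have [|j JIj le_j] := exch I J fI gJ i; first by rewrite inE Ji.
exists (Some j); first by rewrite inE !mem_Some_imset -in_setD.
by rewrite !swap !loop_ext_Some.
Qed.

Lemma eq_exchange (R : realType) (E : finType) (f f' g g' : {set E} -> trop R) :
  f =1 f' -> g =1 g' -> exchange f g -> exchange f' g'.
Proof. by move=> /funext <- /funext <-. Qed.

Lemma add_loop_val (R : realType) (E : finType) (r : nat) (mu : rfun R E r) A :
  vm_val (add_loop mu) A = loop_ext (vm_val mu) A.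
Proof.
rewrite {1}/vm_val; case: insubP => [A' _ eq_A|card_A].
  by rewrite ffunE eq_A.
apply/esym/eqP; apply: contraNT card_A => /loop_ext_fin[B -> /vm_val_card <-].
by rewrite card_Some_imset.
Qed.

(** The double complement arises because restriction to the image is deletion of its complement, and
    the rank of a deletion is that of the complement of the deleted set. *)
Lemma pullback_val (R : realType) (D E : finType) (f : D -> E) (r : nat)
    (nu : rfun R E r) (A : {set D}) :
  vm_val (pullback f nu) A =
  if (#|A| == mrank nu (~: ~: (f @: [set: D]))) && (#|f @: A| == #|A|)
  then vm_val nu (f @: A :|: del_ext nu (~: (f @: [set: D]))) else \oo_t.
Proof.
have eq_im (B : {set D}) : val @: (corestr f @: B) = f @: B.
  by rewrite -imset_comp.
have eq_card (B : {set D}) : #|corestr f @: B| = #|f @: B|.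
  by rewrite -(card_imset (mem (corestr f @: B)) val_inj) eq_im.
rewrite {1}/vm_val; case: insubP => [A' _ eq_A|/negPf-> //].
rewrite ffunE eq_A /is_basis eq_card.
have /eqP card_A : #|A| == mrank nu (~: ~: (f @: [set: D])).
  by rewrite -eq_A; apply: (valP A').
rewrite card_A eqxx andbC /=; case: eqP => //= card_fA.
rewrite {1 2}/vm_val; case: insubP => [B _ eq_B|]; last first.
  by rewrite eq_card card_fA eqxx.
by rewrite ffunE eq_B eq_im; case: eqVneq => [->|].
Qed.

Lemma codom_pr_o (E : finType) (S : {set E}) :
  ~: (pr_o S @: [set: option E]) = Some @: S.
Proof.
apply/setP=> -[x|]; rewrite inE; last first.
  by rewrite (negPf (None_Some_imset _)); apply/negbF/imsetP; exists None.
rewrite mem_Some_imset; have [Sx|Sx] := boolP (x \in S).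
  apply/imsetP=> -[[y|] _] //=; case: ifPn => // Sy [xy].
  by rewrite -xy Sx in Sy.
by apply/negbF/imsetP; exists (Some x); rewrite ?inE //= (negPf Sx).
Qed.

(** Restricting to the image of [pr_o S] deletes exactly the copy of [S], so the pullback is a
    deletion with a loop added. Its [I0] comes from the choice made on [option E] and may differ
    from [del_ext mu S]. *)
Lemma pr_o_pullback (R : realType) (E : finType) (r : nat) (mu : rfun R E r)
    (S : {set E}) :
  (exists B, mu B != \oo_t) ->
  exists I0,
    del_witness r (mrank (add_loop mu) (~: ~: (pr_o S @: [set: option E])))
      S I0 (vm_val mu) /\
    forall A, vm_val (pullback (pr_o S) (add_loop mu)) A =
              loop_ext (del S I0 (vm_val mu)) A.
Proof.
move=> [B0 mu_B0]; have mu'_fin : exists B, add_loop mu B != \oo_t.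
  have : vm_val (add_loop mu) (Some @: val B0) != \oo_t.
    by rewrite add_loop_val loop_ext_Some vm_val_rset.
  by rewrite /vm_val; case: insubP => // B _ _; exists B.
have := del_ext_witness (~: (pr_o S @: [set: option E])) mu'_fin.
set k := mrank _ _; set I1 := del_ext _ _.
rewrite codom_pr_o => -[kr subI card_I rk_le [B fB subB]].
have eq_I1 : I1 = Some @: [set x | Some x \in I1].
  rewrite Some_imset_preim //; apply: contra (None_Some_imset S).
  exact: (subsetP subI).
move: [set x | Some x \in I1] eq_I1 => I0 eq_I1.
rewrite eq_I1 card_Some_imset in subI card_I subB.
have wit : del_witness r k S I0 (vm_val mu).
  split=> //.
  - apply/subsetP=> i I0i.
    by rewrite -mem_Some_imset (subsetP subI) ?mem_Some_imset.
  - move=> A; rewrite -loop_ext_Some -add_loop_val => /rk_le; congr (_ <= _)%N.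
    rewrite -[RHS]card_Some_imset; apply: eq_card => -[i|].
      by rewrite !inE !mem_Some_imset !inE.
    by rewrite inE !(negPf (None_Some_imset _)) andbF.
  move: fB; rewrite add_loop_val => /loop_ext_fin[A eq_B fA]; exists A => //.
  apply/subsetP=> i Ai; have := subsetP subB (Some i).
  by rewrite eq_B mem_Some_imset !inE !mem_Some_imset; apply.
exists I0; split=> // A; rewrite pullback_val -/I1 -/k add_loop_val eq_I1.
(* An image containing [None] gives infinity because [None] is a loop; [A] then contains [None] or
   meets [S], so the other side is infinite too. All other sets are fixed by [pr_o S]. *)
have [oA|oA] := boolP (None \in pr_o S @: A).
  rewrite [LHS](_ : _ = \oo_t); last by rewrite /loop_ext inE oA; case: ifP.
  apply/esym/eqP; apply: contraLR oA => /loop_ext_fin[C ->].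
  rewrite del_fin => /andP[dis _].
  apply/imsetP=> -[_ /imsetP[x Cx ->]] /=.
  by rewrite (negPf (disjoint_notin dis Cx)).
have A_None : None \notin A.
  by apply: contra oA => oA; apply/imsetP; exists None.
rewrite -(Some_imset_preim A_None) in oA *.
move: [set x | Some x \in A] oA => C oA.
have dis : [disjoint C & S].
  rewrite disjoint_subset; apply/subsetP=> x Cx; rewrite inE.
  apply: contra oA => Sx; apply/imsetP; exists (Some x).
    by rewrite mem_Some_imset.
  by rewrite /= Sx.
have -> : pr_o S @: (Some @: C) = Some @: C.
  rewrite -imset_comp; apply: eq_in_imset => x Cx /=.
  by rewrite (negPf (disjoint_notin dis Cx)).
rewrite eqxx andbT -imsetU !loop_ext_Some card_Some_imset.
case: eqP => [_|card_C]; first by rewrite /del dis.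
apply/esym/eqP; apply: contra_notT card_C.
by apply: card_del wit _; apply: vm_val_card.
Qed.

(** * Grassmann-Pluecker relations and the equivalence *)

(** Polynomials being lists, identifying the two blocks merges no terms; each keeps its value at the
    diagonal point. *)
Lemma tvanish_diag (R : realType) (N : finType) (F : tpoly R (N + N)%type)
    (x : tspace R N) :
  tvanish F (tjoin x x) -> tvanish (tpoly_diag F) x.
Proof.
have eq_term (t : trop R * {ffun N + N -> nat}) :
    tterm x (t.1, [ffun v : N => (t.2 (inl v) + t.2 (inr v))%N]) =
    tterm (tjoin x x) t.
  rewrite /tterm /=; congr tadd; rewrite big_sumType /= -big_split /=.
  by apply: eq_bigr => v _; rewrite !ffunE tpowD.
rewrite /tvanish /teval big_map count_map /=.
rewrite (eq_bigr _ (fun t _ => eq_term t)).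
by under [count (preim _ _) _]eq_count do rewrite /= eq_term.
Qed.

Lemma valuated_matroid_gp (R : realType) (E : finType) (r : nat)
    (mu : tvec R (rset E r)) :
  valuated_matroid mu ->
  forall F, @gp_polys R E r F -> hypersurface F (tphi mu).
Proof.
move=> vm_mu _ [_ [I [J [card_I card_J ->]]] <-]; exists mu => //.
apply: tvanish_diag; apply/tvanish_incidence => //.
exact: exchange_incident (vm_exchange vm_mu) _ _ card_I card_J.
Qed.

Theorem theoremA (R : realType) (k n : nat) (hn : (1 <= n)%N)
    (r : 'I_k.+1 -> nat)
    (hr : forall i j : 'I_k.+1, (i <= j)%N -> (r i <= r j)%N)
    (hrn : forall i, (r i <= n)%N)
    (S : 'I_k -> {set 'I_n})
    (mu : forall i : 'I_k.+1, tvec R (rset 'I_n (r i)))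
    (hmu : forall i, valuated_matroid (mu i)) :
  let cur (i : 'I_k) := widen_ord (leqnSn k) i in
  let nxt (i : 'I_k) := lift ord0 i in
  [<-> LFlDr S (fun i => tphi (mu i));
       forall i : 'I_k, vm_quotient (loop_deletion (mu (cur i)) (S i)) (mu (nxt i));
       forall i : 'I_k,
         (tprP (S i) (trop_linear (mu (cur i)))
            `<=` trop_linear (mu (nxt i)))%classic;
       forall i : 'I_k, vm_morphism (mu (nxt i)) (mu (cur i)) (pr_o (S i))].
Proof.
move=> cur nxt.
have card_mu i B : vm_val (mu i) B != \oo_t -> #|B| = r i.
  exact: vm_val_card.
have mu_fin i : exists B, mu i B != \oo_t by have [] := hmu i.
have del_wit i := del_ext_witness (S i) (mu_fin (cur i)).
have del_val i B := loop_deletion_val (S i) B (mu_fin (cur i)).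
have le_r i : (r (cur i) <= r (nxt i))%N.
  by apply: hr; rewrite /= /bump add1n leqnSn.
have Sij_adjacent i : Sij S (cur i) (nxt i) = S i.
  rewrite /Sij (big_pred1 i) // => l.
  by rewrite /= /bump add1n ltnS -eqn_leq eq_sym.
tfae=> [[_ flag] i|quot i|trop i|morph].
- have [rank_le sub _ _ _] := del_wit i.
  apply/vm_quotientP; split; first exact: leq_trans rank_le (le_r i).
  apply: eq_exchange (fsym (del_val i)) (frefl _) _.
  apply: incident_exchange_del (card_mu _) (card_mu _) sub _.
  apply/hypersurface2_incidence; rewrite -Sij_adjacent; apply: flag.
  by rewrite /= /bump add1n.
- have /vm_quotientP[_ exch] := quot i.
  apply/tprP_trop_linear.
  apply: exchange_del_trop_linear (card_mu _) (del_wit i) _.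
  exact: eq_exchange (del_val i) (frefl _) exch.
(* The [I0] of the pullback is not compared with that of (b): the inclusion (c) gives the incidence
   relations, and these give the exchange property for it directly. *)
- have [I0 [wit eq_pull]] := pr_o_pullback (S i) (mu_fin (cur i)).
  have [rank_le sub _ _ _] := wit.
  split=> //; apply/vm_quotientP; split.
    exact: leq_trans rank_le (le_r i).
  apply: eq_exchange (fsym eq_pull) (fsym (add_loop_val _)) _.
  apply/exchange_loop_ext.
  apply: incident_exchange_del (card_mu _) (card_mu _) sub _.
  apply: trop_linear_incident (card_mu _) (vm_exchange (hmu _)) _.
  exact/tprP_trop_linear/trop.
(* Each morphism first gives back the inclusion of (c) for its adjacent pair. *)
have step i x : in_trop_linear (r (cur i)) (vm_val (mu (cur i))) x ->
    in_trop_linear (r (nxt i)) (vm_val (mu (nxt i))) (tpr (S i) x).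
  have [I0 [wit eq_pull]] := pr_o_pullback (S i) (mu_fin (cur i)).
  apply: exchange_del_trop_linear (card_mu _) wit _ x.
  have [_ /vm_quotientP[_ exch]] := morph i.
  apply/exchange_loop_ext.
  exact: eq_exchange eq_pull (@add_loop_val _ _ _ _) exch.
split=> [i|i j lt_ij]; first exact: valuated_matroid_gp.
apply/hypersurface2_incidence.
apply: trop_linear_incident (card_mu _) (vm_exchange (hmu _)) _ => x lin_x.
(* The adjacent inclusions are composed by induction from [i] up to [l], while the projections
   accumulate the union [Sij S i l]; for [l = i] this union is empty. *)
suff compose m (l : 'I_k.+1) : l = m :> nat -> (i <= l)%N ->
    in_trop_linear (r l) (vm_val (mu l)) (tpr (Sij S i l) x).
  exact: compose (erefl _) (ltnW lt_ij).
elim: m l => [|m IHm] l eq_l; rewrite leq_eqVlt => /predU1P[/val_inj <-|lt_il].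
- by rewrite /Sij big_pred0 ?tpr0 // => q; rewrite ltnNge andbN.
- by rewrite eq_l in lt_il.
- by rewrite /Sij big_pred0 ?tpr0 // => q; rewrite ltnNge andbN.
have lt_mk : (m < k)%N by rewrite -ltnS -eq_l.
pose q := Ordinal lt_mk; have -> : l = nxt q by apply: val_inj; exact: eq_l.
have -> : Sij S i (nxt q) = Sij S i (cur q) :|: S q.
  rewrite /Sij (bigD1 q) /= ?leqnn ?andbT; last by rewrite -ltnS -eq_l.
  rewrite setUC; congr (_ :|: _); apply: eq_bigl => p.
  by rewrite /bump add1n ltnS -val_eqE /= [in RHS]ltn_neqAle andbA andbAC.
by rewrite -tpr_comp; apply: step; apply: IHm => //; rewrite /= -ltnS -eq_l.
Qed.
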